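(* Let $0<|q|<1$ and let $a,c,e$ be complex parameters such that all denominators below are nonzero. Then \[\frac{(a;q)_\infty(c;q)_\infty}{(ae;q)_\infty(c/e;q)_\infty} =\sum_{k=0}^{\infty}\frac{(-c^2/e)^k}{(q;q)_{2k}}\, \frac{(ae/c;q)_{2k}}{(ae;q)_{2k}}\, \frac{(a;q)_k(e;q)_k(q/e;q)_k}{(c/e;q)_k}\,q^{\frac{3k^2-k}{2}} \left\{1+q^k\frac{c(1-aq^{3k+1})(1-q^ke)(1-q^{2k}ae/c)}{e(1-q^{1+2k})(1-q^kc/e)(1-aeq^{2k})}\right\}.\]
   Context: For an indeterminate $x$ and $n\in\mathbb{N}_0$, $(x;q)_0=1$, $(x;q)_n=(1-x)(1-qx)\cdots(1-q^{n-1}x)$, and $(x;q)_\infty=\prod_{j\ge0}(1-q^jx)$ for $|q|<1$. *)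

(* Defs.v *)
From Stdlib Require Import Reals.
From Coquelicot Require Import Coquelicot.

Local Open Scope C_scope.

Fixpoint qpoch (x q : C) (n : nat) : C :=
  match n with
  | O => 1
  | S m => qpoch x q m * (1 - q ^ m * x)
  end.

(* Total operator in the style of [RInt]: the limit of the partial products
   when it exists (which is the case whenever Cmod q < 1). *)
Definition qpoch_inf (x q : C) : C :=
  iota (T := C_CompleteNormedModule)
    (fun l : C => filterlim (qpoch x q) eventually (locally l)).

(* Main.v *)
(* Both sides are compared with their values after the substitution
   a -> a q, c -> c q, which multiplies the product side by
   (1 - ae)(1 - c/e) / ((1 - a)(1 - c)). The normalised terms F(m, k), m counting
   the substitutions, satisfy the Wilf-Zeilberger equation
     F(m, k) - F(m+1, k) = G(m, k+1) - G(m, k),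
   where G(m, k) is a rational multiple of F(m, k) with G(m, 0) = 0 and
   |G(m, k)| <= eps_k |q|^m, eps_k -> 0. Summing over k < n and m < M bounds
   the difference of the n-th partial sums of F(0, .) and F(M, .) by a multiple of
   eps_n; as M -> oo, F(M, 0) tends to the quotient of infinite products
   and F(M, k) to 0 for k > 0, so the n-th partial sum of F(0, .) is within
   O(eps_n) of that quotient. *)

Require Import Defs.
From Stdlib Require Import Reals Lra Lia.
From Coquelicot Require Import Coquelicot.
Local Open Scope C_scope.

(** * Convergence and boundedness of complex sequences, through real sequences of moduli *)

Definition cvgC (u : nat -> C) (l : C) : Prop :=
  is_lim_seq (fun n => Cmod (u n - l)) 0%R.

(** The index type is arbitrary so that bounds uniform in a pair (m, k) follow from bounds on
    sequences by reindexing with [bounded_comp]. *)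
Definition Cbounded {I : Type} (f : I -> C) : Prop :=
  exists M : R, forall i, (Cmod (f i) <= M)%R.

Lemma filterlim_cvgC (u : nat -> C) (l : C) :
  filterlim u eventually (locally (T := C_NormedModule) l) <-> cvgC u l.
Proof.
  rewrite (filterlim_locally_ball_norm (U := C_NormedModule)).
  unfold cvgC. rewrite <- is_lim_seq_spec. unfold is_lim_seq'.
  split; intros H eps; destruct (H eps) as [N HN]; exists N; intros n Hn;
    specialize (HN n Hn).
  - rewrite Rminus_0_r, Rabs_pos_eq by apply Cmod_ge_0. exact HN.
  - rewrite Rminus_0_r, Rabs_pos_eq in HN by apply Cmod_ge_0. exact HN.
Qed.

Lemma cvgC_ext (u v : nat -> C) (l : C) :
  (forall n, u n = v n) -> cvgC u l -> cvgC v l.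
Proof.
  intros E. apply is_lim_seq_ext; intros n; now rewrite E.
Qed.

Lemma cvgC_const (l : C) : cvgC (fun _ => l) l.
Proof.
  apply (is_lim_seq_ext (fun _ => 0%R)); [|apply is_lim_seq_const].
  intros _. replace (l - l) with (RtoC 0) by ring. now rewrite Cmod_0.
Qed.

Lemma cvgC_le0 (u : nat -> C) (l : C) (b : nat -> R) :
  (forall n, Cmod (u n - l) <= b n)%R -> is_lim_seq b 0%R -> cvgC u l.
Proof.
  intros H Hb. apply (is_lim_seq_le_le (fun _ => 0%R) _ b).
  - intros n; split; [apply Cmod_ge_0 | apply H].
  - apply is_lim_seq_const.
  - exact Hb.
Qed.

Lemma cvgC_plus (u v : nat -> C) (l m : C) :
  cvgC u l -> cvgC v m -> cvgC (fun n => u n + v n) (l + m).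
Proof.
  intros Hu Hv.
  apply (cvgC_le0 _ _ (fun n => Cmod (u n - l) + Cmod (v n - m))%R).
  - intros n. replace (u n + v n - (l + m)) with ((u n - l) + (v n - m)) by ring.
    apply Cmod_triangle.
  - replace (Finite 0) with (Finite (0 + 0)) by (f_equal; ring).
    now apply is_lim_seq_plus'.
Qed.

Lemma cvgC_mult (u v : nat -> C) (l m : C) :
  cvgC u l -> cvgC v m -> cvgC (fun n => u n * v n) (l * m).
Proof.
  intros Hu Hv.
  apply (cvgC_le0 _ _ (fun n => Cmod (u n - l) * Cmod (v n - m)
    + (Cmod l * Cmod (v n - m) + Cmod m * Cmod (u n - l)))%R).
  - intros n.
    replace (u n * v n - l * m)
      with ((u n - l) * (v n - m) + (l * (v n - m) + m * (u n - l))) by ring.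
    rewrite <- !Cmod_mult.
    eapply Rle_trans; [apply Cmod_triangle|].
    apply Rplus_le_compat_l, Cmod_triangle.
  - replace (Finite 0) with (Finite (0 * 0 + (Cmod l * 0 + Cmod m * 0)))
      by (f_equal; ring).
    apply is_lim_seq_plus'; [now apply is_lim_seq_mult'|].
    apply is_lim_seq_plus'; apply is_lim_seq_mult';
      trivial; apply is_lim_seq_const.
Qed.

Lemma cvgC_Cmod (u : nat -> C) (l : C) :
  cvgC u l -> is_lim_seq (fun n => Cmod (u n)) (Cmod l).
Proof.
  intros Hu.
  apply (is_lim_seq_le_le (fun n => Cmod l - Cmod (u n - l))%R _
    (fun n => Cmod l + Cmod (u n - l))%R).
  - intros n.
    assert (H1 := Cmod_triangle l (u n - l)).
    replace (l + (u n - l)) with (u n) in H1 by ring.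
    assert (H2 := Cmod_triangle (u n) (- (u n - l))).
    replace (u n + - (u n - l)) with l in H2 by ring.
    rewrite Cmod_opp in H2. lra.
  - replace (Finite (Cmod l)) with (Finite (Cmod l - 0)) by (f_equal; ring).
    apply is_lim_seq_minus'; [apply is_lim_seq_const|exact Hu].
  - replace (Finite (Cmod l)) with (Finite (Cmod l + 0)) by (f_equal; ring).
    apply is_lim_seq_plus'; [apply is_lim_seq_const|exact Hu].
Qed.

(** The error is |u_n - l| / (|u_n| |l|), and its denominator tends to |l|^2 > 0. *)
Lemma cvgC_inv (u : nat -> C) (l : C) :
  (forall n, u n <> 0) -> l <> 0 -> cvgC u l -> cvgC (fun n => / u n) (/ l).
Proof.
  intros Hn Hl Hu.
  apply (is_lim_seq_ext (fun n => Cmod (u n - l) * / (Cmod (u n) * Cmod l))%R).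
  - intros n.
    replace (/ u n - / l) with (- (u n - l) * / (u n * l)) by (field; auto).
    rewrite Cmod_mult, Cmod_opp, Cmod_inv, Cmod_mult; trivial.
    now apply Cmult_neq_0.
  - replace (Finite 0) with (Finite (0 * / (Cmod l * Cmod l))) by (f_equal; ring).
    apply is_lim_seq_mult'; [exact Hu|].
    apply (is_lim_seq_inv _ (Finite (Cmod l * Cmod l))).
    + apply is_lim_seq_mult'; [now apply cvgC_Cmod|apply is_lim_seq_const].
    + intros E. injection E as E. apply Cmod_gt_0 in Hl. nra.
Qed.

Lemma cvgC_bounded (u : nat -> C) (l : C) : cvgC u l -> Cbounded u.
Proof.
  intros Hu. destruct (maj_by_pos (fun n => Cmod (u n))) as [M [_ HM]].
  - exists (Cmod l). now apply is_lim_seq_Reals, cvgC_Cmod.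
  - exists M. intros n. specialize (HM n).
    now rewrite Rabs_pos_eq in HM by apply Cmod_ge_0.
Qed.

Lemma bounded_const {I : Type} (z : C) : Cbounded (fun _ : I => z).
Proof. exists (Cmod z). intros _. apply Rle_refl. Qed.

Lemma bounded_comp {I J : Type} (h : J -> I) (f : I -> C) :
  Cbounded f -> Cbounded (fun j => f (h j)).
Proof. intros [M HM]. exists M. intros j. apply HM. Qed.

Lemma bounded_plus {I : Type} (f g : I -> C) :
  Cbounded f -> Cbounded g -> Cbounded (fun i => f i + g i).
Proof.
  intros [M HM] [N HN]. exists (M + N)%R. intros i.
  eapply Rle_trans; [apply Cmod_triangle|]. now apply Rplus_le_compat.
Qed.

Lemma bounded_mult {I : Type} (f g : I -> C) :
  Cbounded f -> Cbounded g -> Cbounded (fun i => f i * g i).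
Proof.
  intros [M HM] [N HN]. exists (M * N)%R. intros i. rewrite Cmod_mult.
  apply Rmult_le_compat; trivial; apply Cmod_ge_0.
Qed.

Lemma bounded_opp {I : Type} (f : I -> C) :
  Cbounded f -> Cbounded (fun i => - f i).
Proof.
  intros [M HM]. exists M. intros i. now rewrite Cmod_opp.
Qed.

Lemma cvgC_bounded_mult_cvg0 (u v : nat -> C) :
  Cbounded u -> cvgC v 0 -> cvgC (fun n => u n * v n) 0.
Proof.
  intros [M HM] Hv.
  apply (cvgC_le0 _ _ (fun n => M * Cmod (v n - 0))%R).
  - intros n. replace (u n * v n - 0) with (u n * (v n - 0)) by ring.
    rewrite Cmod_mult. apply Rmult_le_compat_r; [apply Cmod_ge_0|apply HM].
  - replace (Finite 0) with (Finite (M * 0)) by (f_equal; ring).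
    apply is_lim_seq_mult'; [apply is_lim_seq_const|exact Hv].
Qed.

(** * Real estimates: geometric sums and decay of Gaussian type *)

Lemma pow_antitone (r : R) (i j : nat) :
  (0 <= r <= 1)%R -> (i <= j)%nat -> (r ^ j <= r ^ i)%R.
Proof.
  intros Hr Hij. replace j with (i + (j - i))%nat by lia.
  rewrite pow_add.
  assert (H0 : (0 <= r ^ i)%R) by now apply pow_le.
  assert (H1 : (r ^ (j - i) <= 1)%R)
    by (rewrite <- (pow1 (j - i)); now apply pow_incr).
  nra.
Qed.

Lemma sum_n_geom_le (r : R) (n : nat) :
  (0 <= r < 1)%R -> (sum_n (fun m => r ^ m) n <= / (1 - r))%R.
Proof.
  intros Hr. rewrite sum_n_Reals, tech3 by lra.
  assert (0 <= r ^ S n)%R by (apply pow_le; lra).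
  unfold Rdiv. rewrite <- (Rmult_1_l (/ (1 - r))) at 2.
  apply Rmult_le_compat_r; [apply Rlt_le, Rinv_0_lt_compat; lra|lra].
Qed.

Lemma exp_le_mono (x y : R) : (x <= y)%R -> (exp x <= exp y)%R.
Proof.
  intros [H| ->]; [now apply Rlt_le, exp_increasing|apply Rle_refl].
Qed.

(** Once K r^(k+1) < 1/2, the k-th term is at most M / 2^(k+1). This is the sense in which r^(k^2)
    beats any exponential K^k. *)
Lemma is_lim_seq_pow_square (M K r : R) :
  (0 <= M)%R -> (0 <= K)%R -> (0 <= r < 1)%R ->
  is_lim_seq (fun k => M * (K * r ^ S k) ^ S k)%R 0%R.
Proof.
  intros HM HK Hr.
  assert (Hsmall : is_lim_seq (fun k => K * r ^ S k)%R 0%R).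
  { apply (is_lim_seq_incr_1 (fun k => K * r ^ k)%R).
    replace (Finite 0) with (Finite (K * 0)) by (f_equal; ring).
    apply is_lim_seq_mult'; [apply is_lim_seq_const|].
    apply is_lim_seq_geom. rewrite Rabs_pos_eq; lra. }
  apply is_lim_seq_spec in Hsmall.
  assert (Hhalf : (0 < / 2)%R) by lra.
  destruct (Hsmall (mkposreal _ Hhalf)) as [N HN]; simpl in HN.
  apply (is_lim_seq_le_le_loc (fun _ => 0%R) _ (fun k => M * (/ 2) ^ S k)%R).
  - exists N. intros k Hk. specialize (HN k Hk).
    rewrite Rminus_0_r in HN. apply Rabs_def2 in HN.
    change (r * r ^ k)%R with (r ^ S k)%R in HN.
    assert (H0 : (0 <= K * r ^ S k)%R)
      by (apply Rmult_le_pos; [lra|apply pow_le; lra]).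
    split.
    + apply Rmult_le_pos; [lra|now apply pow_le].
    + apply Rmult_le_compat_l; [lra|]. apply pow_incr. lra.
  - apply is_lim_seq_const.
  - replace (Finite 0) with (Finite (M * 0)) by (f_equal; ring).
    apply is_lim_seq_mult'; [apply is_lim_seq_const|].
    apply (is_lim_seq_incr_1 (fun k => (/ 2) ^ k)%R).
    apply is_lim_seq_geom. rewrite Rabs_pos_eq; lra.
Qed.

(** * q-Pochhammer symbols: bounds, convergence and nonvanishing *)

Section QPochhammer.

Variable q : C.
Hypothesis hq1 : (Cmod q < 1)%R.

Lemma Cmod_pow_le_1 (n : nat) : (Cmod (q ^ n) <= 1)%R.
Proof.
  rewrite Cmod_pow, <- (pow1 n). apply pow_incr.
  split; [apply Cmod_ge_0|lra].
Qed.

Lemma bounded_qpow : Cbounded (fun n => q ^ n).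
Proof. exists 1%R. apply Cmod_pow_le_1. Qed.

Lemma cvgC_qpow : cvgC (fun n => q ^ n) 0.
Proof.
  apply (is_lim_seq_ext (fun n => Cmod q ^ n)%R).
  - intros n. rewrite <- Cmod_pow. f_equal. ring.
  - apply is_lim_seq_geom. rewrite Rabs_pos_eq by apply Cmod_ge_0. exact hq1.
Qed.

(** Each factor satisfies |1 - q^j x| <= 1 + |x| |q|^j <= exp(|x| |q|^j), and the exponents sum to
    at most |x| / (1 - |q|). *)
Lemma bounded_qpoch (x : C) : Cbounded (qpoch x q).
Proof.
  exists (exp (Cmod x * / (1 - Cmod q)))%R.
  assert (H0 := Cmod_ge_0 q). assert (H1 := Cmod_ge_0 x).
  (* [sum_n] up to n has n + 1 terms, so it matches the product of [S n] factors; the empty product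
     is treated apart. *)
  assert (H : forall n,
    (Cmod (qpoch x q (S n)) <= exp (Cmod x * sum_n (fun m => Cmod q ^ m) n))%R).
  { induction n as [|n IH].
    - rewrite sum_O. simpl. rewrite !Cmult_1_l, Rmult_1_r.
      apply Rle_trans with (1 + Cmod x)%R; [|apply exp_ineq1_le].
      eapply Rle_trans; [apply Cmod_triangle|].
      rewrite Cmod_1, Cmod_opp. lra.
    - change (qpoch x q (S (S n))) with (qpoch x q (S n) * (1 - q ^ S n * x)).
      rewrite sum_Sn, Cmod_mult. unfold plus; simpl plus.
      rewrite Rmult_plus_distr_l, exp_plus.
      apply Rmult_le_compat; try apply Cmod_ge_0; [exact IH|].
      eapply Rle_trans; [apply Cmod_triangle|].
      rewrite Cmod_1, Cmod_opp, Cmod_mult, Cmod_pow.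
      rewrite (Rmult_comm (Cmod x)). apply exp_ineq1_le. }
  intros [|n].
  - simpl. rewrite Cmod_1, <- exp_0 at 1. apply exp_le_mono.
    apply Rmult_le_pos; [lra|apply Rlt_le, Rinv_0_lt_compat; lra].
  - eapply Rle_trans; [apply H|]. apply exp_le_mono.
    apply Rmult_le_compat_l; [lra|]. apply sum_n_geom_le. lra.
Qed.

(** Consecutive partial products differ by -(x;q)_n x q^n, which a geometric series dominates since
    (x;q)_n is bounded; completeness then gives a limit. *)
Lemma cvgC_qpoch (x : C) : cvgC (qpoch x q) (qpoch_inf x q).
Proof.
  destruct (bounded_qpoch x) as [M HM].
  assert (H0 := Cmod_ge_0 q). assert (H1 := Cmod_ge_0 x).
  assert (HS : ex_series (V := C_CompleteNormedModule)
    (fun n => qpoch x q (S n) - qpoch x q n)).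
  { apply ex_series_le with (b := fun n => (M * Cmod x * Cmod q ^ n)%R).
    - intros n. change (Cmod (qpoch x q (S n) - qpoch x q n) <= M * Cmod x * Cmod q ^ n)%R.
      replace (qpoch x q (S n) - qpoch x q n) with (- (qpoch x q n * x * q ^ n))
        by (simpl; ring).
      rewrite Cmod_opp, !Cmod_mult, Cmod_pow.
      apply Rmult_le_compat_r; [apply pow_le; lra|].
      apply Rmult_le_compat_r; [lra|apply HM].
    - apply (ex_series_scal_l (K := R_AbsRing) (V := R_NormedModule)).
      exists (/ (1 - Cmod q))%R. apply is_series_geom.
      rewrite Rabs_pos_eq; lra. }
  destruct HS as [l Hl].
  (* The series of differences telescopes to (x;q)_(n+1) - (x;q)_0, whence the shift by 1. *)
  assert (Hlim : cvgC (qpoch x q) (l + 1)).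
  { apply (proj1 (filterlim_cvgC _ _)) in Hl. unfold cvgC.
    apply is_lim_seq_incr_1. revert Hl.
    apply is_lim_seq_ext. intros n. f_equal.
    assert (E : @eq C (sum_n (G := C_NormedModule)
        (fun n => qpoch x q (S n) - qpoch x q n) n) (qpoch x q (S n) - 1)).
    { induction n as [|n IH].
      - rewrite sum_O. simpl. ring.
      - rewrite sum_Sn, IH.
        change (@eq C (qpoch x q (S n) - 1 + (qpoch x q (S (S n)) - qpoch x q (S n)))
          (qpoch x q (S (S n)) - 1)).
        ring. }
    transitivity (qpoch x q (S n) - 1 - l);
      [exact (f_equal (fun z => z - l) E)|ring]. }
  unfold qpoch_inf.
  rewrite (iota_filterlim_locally (V := C_CompleteNormedModule) _ (l + 1)).
  - exact Hlim.
  - now apply filterlim_cvgC.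
Qed.

(** A partial product that vanishes makes all later ones vanish, and so the limit too. Nonzero
    infinite products thus control all the finite denominators built on the same parameter. *)
Lemma qpoch_neq_0 (x : C) (n : nat) : qpoch_inf x q <> 0 -> qpoch x q n <> 0.
Proof.
  intros Hx H0.
  assert (Hz : forall j, qpoch x q (j + n) = 0).
  { induction j as [|j IH]; [exact H0|]. simpl. rewrite IH. ring. }
  assert (H1 := cvgC_Cmod _ _ (cvgC_qpoch x)).
  apply (is_lim_seq_incr_n _ n) in H1.
  apply (is_lim_seq_ext _ (fun _ => 0%R)) in H1.
  - apply is_lim_seq_unique in H1. rewrite Lim_seq_const in H1.
    injection H1 as H1. now apply Hx, Cmod_eq_0.
  - intros j. now rewrite Hz, Cmod_0.
Qed.

Lemma qpoch_factor_neq_0 (x : C) (n : nat) :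
  qpoch_inf x q <> 0 -> 1 - q ^ n * x <> 0.
Proof.
  intros Hx H0. apply (qpoch_neq_0 x (S n) Hx). simpl. rewrite H0. ring.
Qed.

Lemma bounded_qpoch_inv (x : C) :
  qpoch_inf x q <> 0 -> Cbounded (fun n => / qpoch x q n).
Proof.
  intros Hx. apply (cvgC_bounded _ (/ qpoch_inf x q)).
  apply cvgC_inv; [|exact Hx|apply cvgC_qpoch].
  intros n. now apply qpoch_neq_0.
Qed.

(** The inverse factor is the quotient (x;q)_n / (x;q)_(n+1) of bounded sequences. *)
Lemma bounded_qpoch_factor_inv (x : C) :
  qpoch_inf x q <> 0 -> Cbounded (fun n => / (1 - q ^ n * x)).
Proof.
  intros Hx.
  destruct (bounded_mult (qpoch x q) (fun n => / qpoch x q (S n))) as [M HM].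
  - apply bounded_qpoch.
  - apply (bounded_comp S (fun n => / qpoch x q n)), bounded_qpoch_inv, Hx.
  - exists M. intros n. eapply Rle_trans; [|apply (HM n)]. apply Req_le. f_equal.
    simpl. field. split; [now apply qpoch_factor_neq_0|now apply qpoch_neq_0].
Qed.

Lemma one_minus_qpow_S_neq_0 (n : nat) : 1 - q ^ S n <> 0.
Proof.
  intros H. assert (E : q ^ S n = 1) by (rewrite <- (Cplus_0_l (q ^ S n)), <- H; ring).
  apply (f_equal Cmod) in E. rewrite Cmod_pow, Cmod_1 in E.
  assert (H0 := Cmod_ge_0 q). assert (H1 := Cmod_pow_le_1 n).
  rewrite Cmod_pow in H1. simpl in E. assert (0 <= Cmod q ^ n)%R by now apply pow_le.
  nra.
Qed.

Lemma qpoch_q_neq_0 (n : nat) : qpoch q q n <> 0.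
Proof.
  induction n as [|n IH]; simpl.
  - intros E. now apply C1_nz.
  - apply Cmult_neq_0; [exact IH|].
    replace (q ^ n * q) with (q ^ S n) by (simpl; ring).
    apply one_minus_qpow_S_neq_0.
Qed.

(** Every factor has modulus |1 - q^(j+1)| >= 1 - |q|. The bound is crude, but exponential growth is
    harmless against q^(k^2). *)
Lemma Cmod_qpoch_q_inv_le (n : nat) :
  (Cmod (/ qpoch q q n) <= (/ (1 - Cmod q)) ^ n)%R.
Proof.
  rewrite Cmod_inv by apply qpoch_q_neq_0. rewrite pow_inv.
  assert (H0 := Cmod_ge_0 q).
  apply Rinv_le_contravar; [apply pow_lt; lra|].
  induction n as [|n IH]; simpl; [rewrite Cmod_1; lra|].
  rewrite Cmod_mult, Rmult_comm.
  apply Rmult_le_compat; trivial; [apply pow_le; lra|lra|].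
  assert (H1 := Cmod_triangle (1 - q ^ n * q) (q ^ n * q)).
  replace (1 - q ^ n * q + q ^ n * q) with (RtoC 1) in H1 by ring.
  rewrite Cmod_1, (Cmod_mult (q ^ n)) in H1.
  assert (H2 := Cmod_pow_le_1 n). nra.
Qed.

End QPochhammer.

(** * Summing a series by a Wilf-Zeilberger pair *)

Lemma csum_Sn (f : nat -> C) (n : nat) :
  @eq C (sum_n (G := C_NormedModule) f (S n))
    (sum_n (G := C_NormedModule) f n + f (S n)).
Proof. exact (sum_Sn (G := C_NormedModule) f n). Qed.

(** The limit m -> oo is taken only in partial sums of fixed length, so termwise limits suffice and
    no limit is exchanged with an infinite sum. *)
Lemma wz_series (F G : nat -> nat -> C) (P : C) (b : nat -> R) (r : R) :
  (0 <= r < 1)%R ->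
  (forall m k, F m k - F (S m) k = G m (S k) - G m k) ->
  (forall m, G m O = 0) ->
  cvgC (fun m => F m O) P ->
  (forall k, cvgC (fun m => F m (S k)) 0) ->
  (forall m k, Cmod (G m (S k)) <= b k * r ^ m)%R ->
  is_lim_seq b 0%R ->
  is_series (V := C_NormedModule) (F O) P.
Proof.
  intros Hr HWZ HG0 HF0 HFS HG Hb.
  pose (sum f n := (sum_n (G := C_NormedModule) f n : C)).
  (* Telescoping in k: the lower boundary term is [G m O], which is 0. *)
  assert (Hk : forall m n, sum (F m) n - sum (F (S m)) n = G m (S n)).
  { intros m n. unfold sum. induction n as [|n IH].
    - rewrite !sum_O, HWZ, HG0. ring.
    - rewrite !csum_Sn.
      replace (G m (S (S n)))
        with (G m (S n) + (G m (S (S n)) - G m (S n))) by ring.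
      rewrite <- HWZ, <- IH. ring. }
  assert (Hb0 : forall n, (0 <= b n)%R).
  { intros n. apply Rle_trans with (1 := Cmod_ge_0 (G O (S n))).
    rewrite <- (Rmult_1_r (b n)). exact (HG O n). }
  (* Telescoping in m: the boundary terms G(m, n+1) are dominated by a geometric series, uniformly
     in [M]. *)
  assert (HM : forall M n,
    (Cmod (sum (F O) n - sum (F (S M)) n) <= b n * / (1 - r))%R).
  { intros M n.
    apply Rle_trans with (b n * sum_n (fun m => r ^ m) M)%R;
      [|now apply Rmult_le_compat_l, sum_n_geom_le].
    induction M as [|M IH].
    - rewrite sum_O, Hk. apply HG.
    - replace (sum (F O) n - sum (F (S (S M))) n)
        with ((sum (F O) n - sum (F (S M)) n)
              + (sum (F (S M)) n - sum (F (S (S M))) n)) by ring.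
      eapply Rle_trans; [apply Cmod_triangle|].
      rewrite sum_Sn. change plus with Rplus. rewrite Rmult_plus_distr_l.
      apply Rplus_le_compat; [exact IH|]. rewrite Hk. apply HG. }
  (* Only the term k = 0 survives in the limit. *)
  assert (Hlim : forall n, cvgC (fun m => sum (F m) n) P).
  { unfold sum. induction n as [|n IH].
    - apply (cvgC_ext (fun m => F m O)); [|exact HF0].
      intros m. now rewrite sum_O.
    - replace P with (P + 0) by ring.
      apply (cvgC_ext (fun m => sum_n (G := C_NormedModule) (F m) n + F m (S n))).
      + intros m. now rewrite csum_Sn.
      + apply cvgC_plus; [exact IH|apply HFS]. }
  apply filterlim_cvgC, (cvgC_le0 _ _ (fun n => b n * / (1 - r))%R).
  - intros n.
    assert (HL : is_lim_seq (fun m => Cmod (sum (F O) n - sum (F (S m)) n))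
                   (Cmod (sum (F O) n - P))).
    { apply cvgC_Cmod.
      apply (cvgC_ext (fun m => sum (F O) n + (- (1)) * sum (F (S m)) n));
        [intros; ring|].
      replace (sum (F O) n - P) with (sum (F O) n + (- (1)) * P) by ring.
      apply cvgC_plus; [apply cvgC_const|].
      apply cvgC_mult; [apply cvgC_const|].
      apply (is_lim_seq_incr_1 (fun m => Cmod (sum (F m) n - P))), Hlim. }
    exact (is_lim_seq_le _ _ _ _ (fun m => HM m n) HL (is_lim_seq_const _)).
  - replace (Finite 0) with (Finite (0 * / (1 - r))) by (f_equal; ring).
    apply is_lim_seq_mult'; [exact Hb|apply is_lim_seq_const].
Qed.

(** Natural subtraction and division are exact here: k <= 3k^2, and k(3k - 1) is even. *)
Definition pentagonal (k : nat) : nat := (3 * k ^ 2 - k) / 2.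

Lemma pentagonal_S (k : nat) : pentagonal (S k) = (pentagonal k + (3 * k + 1))%nat.
Proof.
  unfold pentagonal.
  replace (3 * S k ^ 2 - S k)%nat with (3 * k ^ 2 - k + (3 * k + 1) * 2)%nat
    by (simpl; nia).
  now rewrite Nat.div_add.
Qed.

(** This replaces the exponent by k^2, for which r^(k^2) = (r^k)^k has the shape required by
    [is_lim_seq_pow_square]. *)
Lemma square_le_pentagonal (k : nat) : (k * k <= pentagonal k)%nat.
Proof.
  induction k as [|k IH]; [apply Nat.le_0_l|]. rewrite pentagonal_S. lia.
Qed.

(** * The Wilf-Zeilberger pair and its functional equation *)

Section WZPair.

Variables q a d e : C.
Hypothesis hq1 : (Cmod q < 1)%R.
Hypothesis hd : d <> 0.
Hypothesis he : e <> 0.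
Hypothesis hae : qpoch_inf (a * e) q <> 0.
Hypothesis hd_inf : qpoch_inf d q <> 0.

(* With [c = d * e], [wz_F m k] is the [k]-th term of the series after the
   substitution [a -> a q^m], [c -> c q^m], multiplied by
   [(a)_m (c)_m / ((ae)_m (c/e)_m)]; the ratio [a e / c = a / d] does not move.
   [wz_base] is the part outside the braces, [wz_odd] the second summand inside. *)
Definition wz_base (m k : nat) : C :=
  (- (d ^ 2 * e)) ^ k * / qpoch q q (2 * k) * q ^ pentagonal k
  * q ^ (m * (2 * k))
  * (qpoch (a / d) q (2 * k) * qpoch e q k * qpoch (q / e) q k
     * qpoch a q (m + k) * qpoch (d * e) q m
     * / qpoch (a * e) q (m + 2 * k) * / qpoch d q (m + k)).

Definition wz_odd (m k : nat) : C :=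
  q ^ m * (q ^ k * d * / (1 - q ^ S (2 * k))
    * (1 - q ^ k * e) * (1 - q ^ (2 * k) * (a / d))
    * (1 - q ^ (m + (3 * k + 1)) * a)
    * / (1 - q ^ (m + 2 * k) * (a * e)) * / (1 - q ^ (m + k) * d)).

Definition wz_F (m k : nat) : C := wz_base m k * (1 + wz_odd m k).

(** The certificate; its factor 1 - q^(2k) provides the vanishing at k = 0. *)
Definition wz_G (m k : nat) : C :=
  - wz_base m k * (1 - q ^ (2 * k)) * / (1 - q ^ (m + k) * d).

(** Stated as a product because [wz_base] may vanish. Powers are split so that the multiplier is a
    rational function of q^m and q^k. *)
Lemma wz_base_S_l (m k : nat) :
  wz_base (S m) k =
  wz_base m k * (q ^ k * q ^ k * (1 - q ^ m * q ^ k * a) * (1 - q ^ m * (d * e))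
    * / (1 - q ^ m * (q ^ k * q ^ k) * (a * e)) * / (1 - q ^ m * q ^ k * d)).
Proof.
  assert (H1 := qpoch_factor_neq_0 q hq1 _ (m + 2 * k) hae).
  assert (H2 := qpoch_factor_neq_0 q hq1 _ (m + k) hd_inf).
  assert (H3 := qpoch_neq_0 q hq1 _ (m + 2 * k) hae).
  assert (H4 := qpoch_neq_0 q hq1 _ (m + k) hd_inf).
  assert (H5 := qpoch_q_neq_0 q hq1 (2 * k)).
  unfold wz_base.
  change (S m + k)%nat with (S (m + k)). change (S m + 2 * k)%nat with (S (m + 2 * k)).
  cbn [qpoch].
  replace (q ^ (S m * (2 * k))) with (q ^ k * q ^ k * q ^ (m * (2 * k)))
    by (rewrite <- !Cpow_add_r; f_equal; lia).
  replace (q ^ m * (q ^ k * q ^ k)) with (q ^ (m + 2 * k))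
    by (rewrite <- !Cpow_add_r; f_equal; lia).
  replace (q ^ m * q ^ k) with (q ^ (m + k)) by apply Cpow_add_r.
  field. repeat split; assumption.
Qed.

(** The shift in k: the pentagonal exponent contributes q^(3k+1), the exponent 2mk contributes
    q^(2m), and the symbols of length 2k gain two factors each. *)
Lemma wz_base_S_r (m k : nat) :
  wz_base m (S k) =
  wz_base m k * (- (d ^ 2 * e) * (q * (q ^ k * (q ^ k * q ^ k)))
    * (q ^ m * q ^ m)
    * / (1 - q ^ k * q ^ k * q) * / (1 - q * (q ^ k * q ^ k) * q)
    * (1 - q ^ k * q ^ k * (a / d)) * (1 - q * (q ^ k * q ^ k) * (a / d))
    * (1 - q ^ k * e) * (1 - q ^ k * (q / e)) * (1 - q ^ m * q ^ k * a)
    * / (1 - q ^ m * (q ^ k * q ^ k) * (a * e))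
    * / (1 - q * (q ^ m * (q ^ k * q ^ k)) * (a * e))
    * / (1 - q ^ m * q ^ k * d)).
Proof.
  assert (H1 := qpoch_factor_neq_0 q hq1 _ (m + 2 * k) hae).
  assert (H1' := qpoch_factor_neq_0 q hq1 _ (S (m + 2 * k)) hae).
  assert (H2 := qpoch_factor_neq_0 q hq1 _ (m + k) hd_inf).
  assert (H3 := qpoch_neq_0 q hq1 _ (m + 2 * k) hae).
  assert (H4 := qpoch_neq_0 q hq1 _ (m + k) hd_inf).
  assert (H5 := qpoch_q_neq_0 q hq1 (2 * k)).
  assert (H6 := one_minus_qpow_S_neq_0 q hq1 (2 * k)).
  assert (H7 := one_minus_qpow_S_neq_0 q hq1 (S (2 * k))).
  unfold wz_base.
  rewrite pentagonal_S.
  replace (2 * S k)%nat with (S (S (2 * k))) by lia.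
  replace (m + S k)%nat with (S (m + k)) by lia.
  replace (m + S (S (2 * k)))%nat with (S (S (m + 2 * k))) by lia.
  replace (m * S (S (2 * k)))%nat with (m + m + m * (2 * k))%nat by lia.
  cbn [qpoch].
  replace (q ^ k * q ^ k) with (q ^ (2 * k))
    by (rewrite <- !Cpow_add_r; f_equal; lia).
  replace (q ^ m * q ^ (2 * k)) with (q ^ (m + 2 * k)) by apply Cpow_add_r.
  replace (q ^ m * q ^ k) with (q ^ (m + k)) by apply Cpow_add_r.
  replace (q * (q ^ k * q ^ (2 * k))) with (q ^ (3 * k + 1))
    by (rewrite <- !Cpow_add_r, <- Cpow_S; f_equal; lia).
  rewrite (Cpow_add_r q (pentagonal k)), (Cpow_add_r q (m + m)), (Cpow_add_r q m m),
    (Cpow_S (- (d ^ 2 * e))), (Cpow_S q (m + 2 * k)), (Cpow_S q (2 * k)).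
  rewrite (Cpow_S q (m + 2 * k)) in H1'.
  rewrite (Cpow_S q (S (2 * k))) in H7. rewrite (Cpow_S q (2 * k)) in H6, H7.
  assert (H6' : 1 - q ^ (2 * k) * q <> 0) by now rewrite Cmult_comm.
  assert (H7' : 1 - q * q ^ (2 * k) * q <> 0)
    by now rewrite (Cmult_comm (q * q ^ (2 * k)) q).
  field. repeat split; assumption.
Qed.

(** By the two shift lemmas every term is [wz_base m k] times a rational function of q^m and q^k, so
    an identity of rational functions remains. *)
Lemma wz_identity (m k : nat) :
  wz_F m k - wz_F (S m) k = wz_G m (S k) - wz_G m k.
Proof.
  assert (H1 := qpoch_factor_neq_0 q hq1 _ (m + 2 * k) hae).
  assert (H1' := qpoch_factor_neq_0 q hq1 _ (S (m + 2 * k)) hae).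
  assert (H2 := qpoch_factor_neq_0 q hq1 _ (m + k) hd_inf).
  assert (H2' := qpoch_factor_neq_0 q hq1 _ (S (m + k)) hd_inf).
  assert (H6 := one_minus_qpow_S_neq_0 q hq1 (2 * k)).
  assert (H7 := one_minus_qpow_S_neq_0 q hq1 (S (2 * k))).
  unfold wz_F, wz_G. rewrite wz_base_S_l, wz_base_S_r. unfold wz_odd.
  replace (2 * S k)%nat with (S (S (2 * k))) by lia.
  replace (m + S k)%nat with (S (m + k)) by lia.
  change (S m + k)%nat with (S (m + k)).
  change (S m + 2 * k)%nat with (S (m + 2 * k)).
  change (S m + (3 * k + 1))%nat with (S (m + (3 * k + 1))).
  replace (m + (3 * k + 1))%nat with (S (m + (k + 2 * k))) by lia.
  rewrite !Cpow_S, !Cpow_add_r in *.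
  replace (q ^ (2 * k)) with (q ^ k * q ^ k) in *
    by (rewrite <- Cpow_add_r; f_equal; lia).
  revert H1 H1' H2 H2' H6 H7.
  (* From here on q^m and q^k are treated as independent indeterminates. *)
  generalize (wz_base m k) (q ^ m) (q ^ k). intros b M Q H1 H1' H2 H2' H6 H7.
  assert (H6' : 1 - Q * Q * q <> 0) by now rewrite Cmult_comm.
  assert (H7' : 1 - q * (Q * Q) * q <> 0)
    by now rewrite (Cmult_comm (q * (Q * Q)) q).
  field. repeat split; assumption.
Qed.

(** * Limits and bounds for the pair *)

Ltac bounded_tac :=
  repeat first
    [ apply bounded_const
    | apply bounded_mult | apply bounded_plus | apply bounded_opp
    | apply (bounded_comp _ (fun n => q ^ n)), bounded_qpow, hq1
    | apply (bounded_comp _ (fun n => / (1 - q ^ n * (a * e)))),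
        bounded_qpoch_factor_inv; trivial
    | apply (bounded_comp _ (fun n => / (1 - q ^ n * d))),
        bounded_qpoch_factor_inv; trivial
    | apply (bounded_comp _ (fun n => / qpoch (a * e) q n)),
        bounded_qpoch_inv; trivial
    | apply (bounded_comp _ (fun n => / qpoch d q n)),
        bounded_qpoch_inv; trivial
    | apply bounded_qpoch, hq1
    | match goal with
      |- Cbounded (fun i => qpoch ?x q _) =>
        apply (bounded_comp _ (qpoch x q)), bounded_qpoch, hq1
      end ].

Lemma cvgC_qpow_bounded_mult (u : nat -> C) :
  Cbounded u -> cvgC (fun m => q ^ m * u m) 0.
Proof.
  intros Hu. apply (cvgC_ext (fun m => u m * q ^ m)); [intros; ring|].
  now apply cvgC_bounded_mult_cvg0, cvgC_qpow.
Qed.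

Lemma wz_odd_cvg0 (k : nat) : cvgC (fun m => wz_odd m k) 0.
Proof.
  apply cvgC_qpow_bounded_mult. unfold Cminus. bounded_tac.
Qed.

(** For a positive second index, q^(2m(k+1)) yields a spare factor q^m, and the rest is bounded in
    m. *)
Lemma wz_base_S_cvg0 (k : nat) : cvgC (fun m => wz_base m (S k)) 0.
Proof.
  apply (cvgC_ext (fun m => q ^ m *
    ((- (d ^ 2 * e)) ^ S k * / qpoch q q (2 * S k) * q ^ pentagonal (S k)
     * q ^ (m * (2 * k + 1))
     * (qpoch (a / d) q (2 * S k) * qpoch e q (S k) * qpoch (q / e) q (S k)
        * qpoch a q (m + S k) * qpoch (d * e) q m
        * / qpoch (a * e) q (m + 2 * S k) * / qpoch d q (m + S k))))).
  - intros m. unfold wz_base.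
    replace (m * (2 * S k))%nat with (m + m * (2 * k + 1))%nat by lia.
    rewrite Cpow_add_r. ring.
  - apply cvgC_qpow_bounded_mult. bounded_tac.
Qed.

Lemma wz_base_0_cvg :
  cvgC (fun m => wz_base m 0)
    (qpoch_inf a q * qpoch_inf (d * e) q
     / (qpoch_inf (a * e) q * qpoch_inf d q)).
Proof.
  apply (cvgC_ext (fun m => qpoch a q m * qpoch (d * e) q m
    * (/ qpoch (a * e) q m * / qpoch d q m))).
  - intros m. unfold wz_base.
    change (pentagonal 0) with O. rewrite !Nat.mul_0_r, !Nat.add_0_r.
    cbn [Cpow qpoch]. field.
    split; now apply qpoch_neq_0.
  - replace (qpoch_inf a q * qpoch_inf (d * e) q
       / (qpoch_inf (a * e) q * qpoch_inf d q))
      with (qpoch_inf a q * qpoch_inf (d * e) q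
       * (/ qpoch_inf (a * e) q * / qpoch_inf d q)) by (field; auto).
    repeat apply cvgC_mult; try now apply cvgC_qpoch.
    + apply cvgC_inv; trivial; [|now apply cvgC_qpoch].
      intros n. now apply qpoch_neq_0.
    + apply cvgC_inv; trivial; [|now apply cvgC_qpoch].
      intros n. now apply qpoch_neq_0.
Qed.

(** The second summand in the braces carries q^m, so the braces tend to 1. *)
Lemma wz_F_cvg (k : nat) (l : C) :
  cvgC (fun m => wz_base m k) l -> cvgC (fun m => wz_F m k) l.
Proof.
  intros H. replace l with (l * (1 + 0)) by ring.
  apply cvgC_mult; [exact H|].
  apply cvgC_plus; [apply cvgC_const|apply wz_odd_cvg0].
Qed.

(** At index k + 1, |d^2 e|^(k+1) and 1/(q;q)_(2k+2) account for K^(k+1), the pentagonal power for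
    |q|^((k+1)^2), and q^(2m(k+1)) for |q|^m because k + 1 >= 1. All other factors are bounded by
    M. *)
Lemma wz_G_bound :
  exists M K : R, (0 <= M)%R /\ (0 <= K)%R /\
    forall m k, (Cmod (wz_G m (S k))
      <= M * (K * Cmod q ^ S k) ^ S k * Cmod q ^ m)%R.
Proof.
  (* Indexing by pairs makes this bound uniform in m and k together. *)
  assert (HB : Cbounded (fun p : nat * nat =>
    (qpoch (a / d) q (2 * snd p) * qpoch e q (snd p) * qpoch (q / e) q (snd p)
     * qpoch a q (fst p + snd p) * qpoch (d * e) q (fst p)
     * / qpoch (a * e) q (fst p + 2 * snd p) * / qpoch d q (fst p + snd p))
    * (1 + - q ^ (2 * snd p)) * / (1 - q ^ (fst p + snd p) * d))).
  { bounded_tac. }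
  destruct HB as [M HM].
  assert (Hq0 := Cmod_ge_0 q).
  assert (Hd0 := Cmod_ge_0 (d ^ 2 * e)).
  assert (Hi : (0 < / (1 - Cmod q))%R) by (apply Rinv_0_lt_compat; lra).
  exists M, (Cmod (d ^ 2 * e) * (/ (1 - Cmod q)) ^ 2)%R.
  split; [|split].
  - eapply Rle_trans; [apply Cmod_ge_0|apply (HM (O, O))].
  - apply Rmult_le_pos; [exact Hd0|apply pow_le; lra].
  - intros m k.
    unfold wz_G, wz_base.
    replace (- _ * _ * _) with
      (- ((- (d ^ 2 * e)) ^ S k * / qpoch q q (2 * S k) * q ^ pentagonal (S k)
          * q ^ (m * (2 * S k))
          * (qpoch (a / d) q (2 * S k) * qpoch e q (S k) * qpoch (q / e) q (S k)
             * qpoch a q (m + S k) * qpoch (d * e) q m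
             * / qpoch (a * e) q (m + 2 * S k) * / qpoch d q (m + S k)
             * (1 + - q ^ (2 * S k)) * / (1 - q ^ (m + S k) * d)))) by ring.
    specialize (HM (m, S k)). cbn [fst snd] in HM.
    rewrite Cmod_opp, Cmod_mult, 3!(Cmod_mult (_ * _)), (Cmod_mult (_ ^ _)),
      !(Cmod_pow q), (Cmod_pow (- _)), Cmod_opp.
    rewrite <- (Cmod_mult _ (/ (1 - q ^ (m + S k) * d))).
    rewrite !Rpow_mult_distr, <- !pow_mult.
    apply Rle_trans with (Cmod (d ^ 2 * e) ^ S k * (/ (1 - Cmod q)) ^ (2 * S k)
      * Cmod q ^ (S k * S k) * Cmod q ^ m * M)%R; [|apply Req_le; ring].
    do 4 (try apply Rmult_le_compat); try exact HM;
      repeat apply Rmult_le_pos; try apply Cmod_ge_0;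
      try (apply pow_le; lra).
    + apply Rle_refl.
    + now apply Cmod_qpoch_q_inv_le.
    + apply pow_antitone; [lra|apply square_le_pentagonal].
    + apply pow_antitone; [lra|nia].
Qed.

Lemma wz_F_series :
  is_series (V := C_NormedModule) (wz_F 0)
    (qpoch_inf a q * qpoch_inf (d * e) q
     / (qpoch_inf (a * e) q * qpoch_inf d q)).
Proof.
  destruct wz_G_bound as (M & K & HM & HK & HG).
  assert (Hq0 := Cmod_ge_0 q).
  apply (wz_series wz_F wz_G _ (fun k => M * (K * Cmod q ^ S k) ^ S k)%R (Cmod q)).
  - lra.
  - exact wz_identity.
  - intros m. unfold wz_G. rewrite Nat.mul_0_r. cbn [Cpow]. ring.
  - apply wz_F_cvg, wz_base_0_cvg.
  - intros k. apply wz_F_cvg, wz_base_S_cvg0.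
  - exact HG.
  - apply is_lim_seq_pow_square; lra.
Qed.

End WZPair.

(** * The identity as the row m = 0 of the pair *)

Theorem theorem2 (q a c e : C)
  (hq0 : (0 < Cmod q)%R) (hq1 : (Cmod q < 1)%R)
  (hc : c <> 0) (he : e <> 0)
  (hae : qpoch_inf (a * e) q <> 0)
  (hce : qpoch_inf (c / e) q <> 0) :
  is_series
    (fun k : nat =>
       (- (c ^ 2) / e) ^ k / qpoch q q (2 * k)
       * (qpoch (a * e / c) q (2 * k) / qpoch (a * e) q (2 * k))
       * (qpoch a q k * qpoch e q k * qpoch (q / e) q k / qpoch (c / e) q k)
       * q ^ ((3 * k ^ 2 - k) / 2)
       * (1 + q ^ k
              * ((c * (1 - a * q ^ (3 * k + 1)) * (1 - q ^ k * e)
                    * (1 - q ^ (2 * k) * (a * e) / c))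
                 / (e * (1 - q ^ (1 + 2 * k)) * (1 - q ^ k * c / e)
                    * (1 - a * e * q ^ (2 * k))))))
    (qpoch_inf a q * qpoch_inf c q
     / (qpoch_inf (a * e) q * qpoch_inf (c / e) q)).
Proof.
  assert (hd : c / e <> 0).
  { intros H. apply hc. replace c with (c / e * e) by (field; exact he).
    rewrite H. ring. }
  (* With d = c/e one has d e = c, a/d = a e/c and d^2 e = c^2/e; what remains is a termwise
     comparison. *)
  assert (Hs := wz_F_series q a (c / e) e hq1 hd he hae hce).
  replace (c / e * e) with c in Hs by (field; exact he).
  revert Hs. apply is_series_ext. intros k.
  assert (H1 := qpoch_factor_neq_0 q hq1 _ (2 * k) hae).
  assert (H2 := qpoch_factor_neq_0 q hq1 _ k hce).
  assert (H3 := qpoch_neq_0 q hq1 _ (2 * k) hae).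
  assert (H4 := qpoch_neq_0 q hq1 _ k hce).
  assert (H5 := qpoch_q_neq_0 q hq1 (2 * k)).
  assert (H6 := one_minus_qpow_S_neq_0 q hq1 (2 * k)).
  unfold wz_F, wz_base, wz_odd. fold (pentagonal k).
  replace (c / e * e) with c by (field; exact he).
  replace (a / (c / e)) with (a * e / c) by (field; auto).
  replace (- ((c / e) ^ 2 * e)) with (- (c ^ 2) / e) by (field; exact he).
  rewrite !Nat.add_0_l, Nat.mul_0_l.
  change (1 + 2 * k)%nat with (S (2 * k)).
  change (q ^ 0) with (RtoC 1). change (qpoch c q 0) with (RtoC 1).
  f_equal; field; repeat split; trivial.
  (* [field] returns denominators in its own normal form; these two are rewritten as factors known
     to be nonzero. *)
  - replace (a * e * q ^ (2 * k)) with (q ^ (2 * k) * (a * e)) by ring. exact H1.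
  - replace (e - q ^ k * c) with (e * (1 - q ^ k * (c / e))) by (field; exact he).
    now apply Cmult_neq_0.
Qed.
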